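(* Let $\Omega\subset\mathbb{R}^d$ be open and bounded, let $\nu:\mathbb{R}^d\setminus\{0\}\to[0,\infty)$ be a symmetric Lévy density with full support and $\int_{\mathbb{R}^d}\nu(h)\,dh=\infty$, and let $k:(\mathbb{R}^d\times\mathbb{R}^d)\setminus\operatorname{diag}\to[0,\infty)$ be symmetric and measurable with $\Lambda^{-1}\nu(y-x)\le k(x,y)\le\Lambda\nu(y-x)$ for all $x\ne y$ and some $\Lambda\ge1$. Let $\lambda\in\mathbb{R}$ not be a Dirichlet eigenvalue of $L$ on $\Omega$, and let $\beta:\Omega^c\to\mathbb{R}$ be measurable. Let $\mathscr{D}_\lambda:T_\nu(\Omega^c)\to T_\nu(\Omega^c)'$ be the Dirichlet-to-Neumann map and $L_\beta$ the operator $L$ subject to the Robin condition $\mathcal{N}u+\beta u=0$ on $\Omega^c$. Then $0\in\sigma_p(\mathscr{D}_\lambda+\beta)$ if and only if $\lambda\in\sigma_p(L_\beta)$. In addition, $\dim\ker(L_\beta-\lambda)=\dim\ker(\mathscr{D}_\lambda+\beta)$.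
   Context: A symmetric Lévy density is a measurable $\nu\ge0$ with $\nu(h)=\nu(-h)$ and $\int_{\mathbb{R}^d}(1\wedge|h|^2)\nu(h)\,dh<\infty$; full support means $\operatorname{supp}(\nu(h)dh)=\mathbb{R}^d$. $V_\nu(\Omega|\mathbb{R}^d)$ is the space of (a.e.-classes of) measurable $u:\mathbb{R}^d\to\mathbb{R}$ with $u|_\Omega\in L^2(\Omega)$ and $|u|^2=\int_\Omega\int_{\mathbb{R}^d}(u(x)-u(y))^2\nu(x-y)\,dy\,dx<\infty$, normed by $\|u\|^2=\|u\|^2_{L^2(\Omega)}+|u|^2$. $\mathcal{E}(u,v)=\frac12\iint_{(\Omega^c\times\Omega^c)^c}(u(x)-u(y))(v(x)-v(y))k(x,y)\,dx\,dy$, $\mathcal{E}_{-\lambda}(u,v)=\mathcal{E}(u,v)-\lambda\int_\Omega uv\,dx$. $V_{\nu,0}(\Omega|\mathbb{R}^d)=\{u\in V_\nu(\Omega|\mathbb{R}^d):u=0\text{ a.e. on }\Omega^c\}$. $T_\nu(\Omega^c)=\{u|_{\Omega^c}:u\in V_\nu(\Omega|\mathbb{R}^d)\}$ with the quotient norm $\|v\|=\inf\{\|u\|:u|_{\Omega^c}=v\}$ and dual $T_\nu(\Omega^c)'$. $\lambda$ is a Dirichlet eigenvalue if there is $0\ne\psi\in V_{\nu,0}(\Omega|\mathbb{R}^d)$ with $\mathcal{E}(\psi,v)=\lambda\int_\Omega\psi v\,dx$ for all $v\in V_{\nu,0}(\Omega|\mathbb{R}^d)$. If it is not, then for $g\in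 T_\nu(\Omega^c)$ there is a unique $u_g\in V_\nu(\Omega|\mathbb{R}^d)$ with $u_g=g$ a.e. on $\Omega^c$ and $\mathcal{E}_{-\lambda}(u_g,v)=0$ for all $v\in V_{\nu,0}(\Omega|\mathbb{R}^d)$, and the Dirichlet-to-Neumann map is $\langle\mathscr{D}_\lambda g,v\rangle=\mathcal{E}_{-\lambda}(u_g,\widetilde v)$ for $v\in T_\nu(\Omega^c)$, with $\widetilde v\in V_\nu(\Omega|\mathbb{R}^d)$ any extension of $v$ (this is independent of the extension, and corresponds to $\mathscr{D}_\lambda g=\mathcal{N}u_g$ with $\mathcal{N}u(y)=\int_\Omega(u(y)-u(x))k(x,y)\,dx$). Kernels and point spectra are understood weakly: $\ker(L_\beta-\lambda)$ is the space of $u\in V_\nu(\Omega|\mathbb{R}^d)$ such that for all $v\in V_\nu(\Omega|\mathbb{R}^d)$ the integral $\int_{\Omega^c}uv\beta\,dy$ converges absolutely and $\mathcal{E}(u,v)+\int_{\Omega^c}u(y)v(y)\beta(y)\,dy=\lambda\int_\Omega u(x)v(x)\,dx$; $\ker(\mathscr{D}_\lambda+\beta)$ is the space of $g\in T_\nu(\Omega^c)$ such that for all $v\in T_\nu(\Omega^c)$ the integral $\int_{\Omega^c}gv\beta\,dy$ converges absolutely and $\langle\mathscr{D}_\lambda g,v\rangle+\int_{\Omega^c}g(y)v(y)\beta(y)\,dy=0$. $\lambda\in\sigma_p(L_\beta)$ means $\ker(L_\beta-\lambda)\ne\{0\}$, and $0\in\sigma_p(\mathscr{D}_\lambda+\beta)$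 means $\ker(\mathscr{D}_\lambda+\beta)\ne\{0\}$. *)

(* Defs.v *)
From HB Require Import structures.
From mathcomp Require Import all_boot all_order all_algebra.
From mathcomp Require Import all_classical all_reals all_analysis.

Set Implicit Arguments.
Unset Strict Implicit.
Unset Printing Implicit Defensive.

Import Order.TTheory GRing.Theory Num.Theory.
Import numFieldNormedType.Exports.

Local Open Scope classical_set_scope.
Local Open Scope ring_scope.

(** * Lebesgue measure on [R^d]

    [R^d] is ['rV[R]_d]. Its sigma-algebra is generated by the coordinates,
    as the library does for tuples; this is the Borel sigma-algebra. *)

Definition rV_display : measure_display -> measure_display.
Proof. exact. Qed.

Section measurable_rV.
Context (R : realType) (d : nat).

Definition rV_coord (i : 'I_d) (v : 'rV[R]_d) : measurableTypeR R := v ord0 i.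

Let rV_set0 : g_sigma_preimage rV_coord set0.
Proof. exact: sigma_algebra0. Qed.

Let rV_setC A : g_sigma_preimage rV_coord A -> g_sigma_preimage rV_coord (~` A).
Proof. exact: sigma_algebraC. Qed.

Let rV_bigcup (F : (set 'rV[R]_d)^nat) :
  (forall i, g_sigma_preimage rV_coord (F i)) ->
  g_sigma_preimage rV_coord (\bigcup_i (F i)).
Proof. exact: sigma_algebra_bigcup. Qed.

HB.instance Definition _ := @isMeasurable.Build (rV_display default_measure_display)
  'rV[R]_d (g_sigma_preimage rV_coord) rV_set0 rV_setC rV_bigcup.

End measurable_rV.

Section measurable_rV_theory.
Context (R : realType).

Lemma measurable_rV_coord (d : nat) (i : 'I_d) :
  measurable_fun [set: 'rV[R]_d] (@rV_coord R d i).
Proof.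
move=> _ Y mY; rewrite setTI; apply: sub_sigma_algebra => /=.
rewrite -bigcup_seq/=; exists i => /=; first by rewrite mem_index_enum.
by exists Y => //; rewrite setTI.
Qed.

Lemma measurable_fun_rVP d1 (T : measurableType d1) (d : nat) (f : T -> 'rV[R]_d) :
  (forall i, measurable_fun [set: T] (@rV_coord R d i \o f)) ->
  measurable_fun [set: T] f.
Proof.
move=> mf _ A mA; rewrite setTI.
suff: g_sigma_preimage (@rV_coord R d) `<=` [set A | measurable (f @^-1` A)].
  exact.
apply: smallest_sub.
  split => /=.
  - by rewrite preimage_set0.
  - by move=> B mB; rewrite setTD preimage_setC; exact: measurableC.
  - by move=> F mF; rewrite preimage_bigcup; exact: bigcup_measurable.
move=> B; rewrite -bigcup_seq/= => -[i _ [C mC <-]].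
by rewrite setTI -comp_preimage -[X in measurable X]setTI; exact: mf.
Qed.

Definition cons_rV (d : nat) (p : measurableTypeR R * 'rV[R]_d) : 'rV[R]_d.+1 :=
  row_mx (const_mx p.1 : 'rV[R]_1) p.2.

Lemma measurable_cons_rV d : measurable_fun setT (@cons_rV d).
Proof.
apply: measurable_fun_rVP => i.
case: (@fintype.split_ordP 1 d i) => j ij.
- rewrite (_ : _ \o _ = fst); first exact: measurable_fst.
  apply/funext => p; rewrite /rV_coord /cons_rV/= ij.
  by rewrite (@row_mxEl _ 1 1 d) mxE.
- rewrite (_ : _ \o _ = @rV_coord R d j \o snd).
    by apply: measurableT_comp; [exact: measurable_rV_coord|exact: measurable_snd].
  apply/funext => p; rewrite /rV_coord /cons_rV/= ij.
  by rewrite (@row_mxEr _ 1 1 d).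
Qed.

Definition uncons_rV (d : nat) (v : 'rV[R]_d.+1) :
  measurableTypeR R * 'rV[R]_d := (v ord0 ord0, \row_i v ord0 (lift ord0 i)).

Lemma measurable_uncons_rV d : measurable_fun setT (@uncons_rV d).
Proof.
apply: measurable_fun_pair; first exact: measurable_rV_coord.
apply: measurable_fun_rVP => i; rewrite (_ : _ \o _ = rV_coord (lift ord0 i)).
  exact: measurable_rV_coord.
by apply/funext => v; rewrite /rV_coord/= mxE.
Qed.

Lemma cons_rVK d : cancel (@cons_rV d) (@uncons_rV d).
Proof.
move=> [x v]; rewrite /uncons_rV /cons_rV/=; congr pair.
  rewrite (_ : ord0 = lshift d (ord0 : 'I_1)); last exact/val_inj.
  by rewrite (@row_mxEl _ 1 1 d) mxE.
apply/rowP => i; rewrite mxE (_ : lift ord0 i = rshift 1 i); last exact/val_inj.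
by rewrite (@row_mxEr _ 1 1 d).
Qed.

End measurable_rV_theory.

Section lebesgue_rV_succ.
Context (R : realType) (d : nat).
Context (m : {sigma_finite_measure set 'rV[R]_d -> \bar R}).

Definition lebesgue_rV_succ : set 'rV[R]_d.+1 -> \bar R :=
  pushforward (@lebesgue_measure R \x m)%E (@cons_rV R d).

Let succ0 : lebesgue_rV_succ set0 = 0%E.
Proof. by rewrite /lebesgue_rV_succ /pushforward preimage_set0 measure0. Qed.

Let succ_ge0 A : (0 <= lebesgue_rV_succ A)%E.
Proof. by rewrite /lebesgue_rV_succ /pushforward; exact: measure_ge0. Qed.

Let succ_sigma_additive : semi_sigma_additive lebesgue_rV_succ.
Proof.
move=> F mF tF mUF; rewrite /lebesgue_rV_succ /pushforward preimage_bigcup.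
have mcons A : measurable A -> measurable (@cons_rV R d @^-1` A).
  by move=> mA; rewrite -[X in measurable X]setTI; exact: measurable_cons_rV.
apply: measure_semi_sigma_additive.
- by move=> n; exact: mcons.
- apply/trivIsetP => /= i j _ _ ij; rewrite -preimage_setI.
  by move/trivIsetP : tF => /(_ _ _ _ _ ij) ->//; rewrite preimage_set0.
- by rewrite -preimage_bigcup; exact: mcons.
Qed.

HB.instance Definition _ := isMeasure.Build _ _ _ lebesgue_rV_succ
  succ0 succ_ge0 succ_sigma_additive.

Let succ_sigma_finite : sigma_finite setT lebesgue_rV_succ.
Proof.
have /sigma_finiteP[F [TF ndF Foo]] := sigma_finiteT (@lebesgue_measure R).
have /sigma_finiteP[G [TG ndG Goo]] := sigma_finiteT m.
exists (fun k => @uncons_rV R d @^-1` (F k `*` G k)).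
  rewrite -preimage_bigcup -(preimage_setT (@uncons_rV R d)); congr (_ @^-1` _).
  rewrite -setXTT TF TG predeqE => -[x y]; split.
    move=> [/= [n _ Fnx] [k _ Gky]]; exists (maxn n k) => //; split.
    - by move: x Fnx; exact/subsetPset/ndF/leq_maxl.
    - by move: y Gky; exact/subsetPset/ndG/leq_maxr.
  by move=> [n _ []/= ? ?]; split; exists n.
move=> k; have [mF Fk] := Foo k; have [mG Gk] := Goo k; split.
  rewrite -[X in measurable X]setTI; apply: measurable_uncons_rV => //.
  exact: measurableX.
rewrite /lebesgue_rV_succ /pushforward -comp_preimage.
rewrite (_ : _ \o _ = id); last by apply/funext => p; exact: cons_rVK.
by rewrite preimage_id product_measure1E// lte_mul_pinfty// ge0_fin_numE.
Qed.

HB.instance Definition _ := Measure_isSigmaFinite.Build _ _ _ lebesgue_rV_succ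
  succ_sigma_finite.

End lebesgue_rV_succ.

Fixpoint lebesgue_rV (R : realType) (d : nat) :
    {sigma_finite_measure set 'rV[R]_d -> \bar R} :=
  match d with
  | 0 => dirac (0 : 'rV[R]_0)
  | d'.+1 => lebesgue_rV_succ (lebesgue_rV R d')
  end.

(** * Dimension of a quotient

    Spaces of a.e.-classes are represented by a subspace [K] of functions and
    the subspace [N] of null functions, the space of classes being [K / N]. *)

Section quotient_dimension.
Context (R : fieldType).

Definition free_mod (V : lmodType R) (N B : set V) :=
  forall (n : nat) (b : 'I_n -> V) (a : 'I_n -> R),
    injective b -> (forall i, B (b i)) ->
    N (\sum_(i < n) a i *: b i) -> forall i, a i = 0.

Definition span_mod (V : lmodType R) (N K B : set V) :=
  forall f, K f -> exists (n : nat) (b : 'I_n -> V) (a : 'I_n -> R),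
    (forall i, B (b i)) /\ N (f - \sum_(i < n) a i *: b i).

Definition basis_mod (V : lmodType R) (N K B : set V) :=
  [/\ B `<=` K, free_mod N B & span_mod N K B].

(** [dim (K1 / N1) = dim (K2 / N2)], as an equality of cardinals. *)
Definition eq_dim_mod (V1 V2 : lmodType R) (N1 K1 : set V1) (N2 K2 : set V2) :=
  exists (B1 : set V1) (B2 : set V2),
    [/\ basis_mod N1 K1 B1, basis_mod N2 K2 B2 & (B1 #= B2)%card].

End quotient_dimension.

(** * Function spaces and forms *)

Section nonlocal.
Context (R : realType) (d : nat).
Local Notation E := 'rV[R]_d.
Local Notation mu := (lebesgue_rV R d).

(** The norm of ['rV[R]_d] in the library is the sup norm. *)
Definition sqnorm (h : E) : R := \sum_(i < d) h ord0 i ^+ 2.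

(** [nu] is a function on [R^d \ {0}]; its value at [0] is irrelevant. *)
Definition symmetric_levy_density (nu : E -> R) :=
  [/\ measurable_fun [set~ (0 : E)] nu,
      forall h, h != 0 -> 0 <= nu h,
      forall h, h != 0 -> nu (- h) = nu h &
      (\int[mu]_h (Num.min 1 (sqnorm h) * nu h)%:E < +oo)%E].

(** Topological support of the measure [nu(h) dh]. *)
Definition density_support (nu : E -> R) : set E :=
  [set x | forall U : set E, open U -> U x ->
    (0 < \int[mu]_(h in U) (nu h)%:E)%E].

(** The functions that are zero as a.e.-classes on [D]. *)
Definition null_on (D : set E) : set (E -> R) :=
  [set f | ae_eq mu D f (cst 0)].

Section spaces.
Context (Omega : set E) (nu : E -> R).

Definition sqL2 (u : E -> R) : \bar R :=
  (\int[mu]_(x in Omega) (u x ^+ 2)%:E)%E.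

Definition sqseminorm (u : E -> R) : \bar R :=
  (\int[mu]_(x in Omega) \int[mu]_y ((u x - u y) ^+ 2 * nu (x - y))%:E)%E.

Definition V_space : set (E -> R) :=
  [set u | [/\ measurable_fun setT u, (sqL2 u < +oo)%E & (sqseminorm u < +oo)%E]].

Definition V_norm (u : E -> R) : R := Num.sqrt (fine (sqL2 u + sqseminorm u)%E).

Definition V0_space : set (E -> R) :=
  V_space `&` [set u | ae_eq mu (~` Omega) u (cst 0)].

(** Functions on the complement of [Omega] are represented by functions on the
    whole space, whose values in [Omega] are never used; two of them are equal
    as a.e.-classes when their difference is in [null_on (~` Omega)]. *)
Definition trace_space : set (E -> R) :=
  [set g | exists2 u, V_space u & forall y, ~ Omega y -> g y = u y].

Definition extension (g : E -> R) : set (E -> R) :=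
  V_space `&` [set u | ae_eq mu (~` Omega) u g].

Definition trace_norm (g : E -> R) : R := inf [set V_norm u | u in extension g].

Definition trace_dual : set ((E -> R) -> R) :=
  [set phi |
    (forall (a : R) v w, trace_space v -> trace_space w ->
      phi (fun y => a * v y + w y) = a * phi v + phi w) /\
    exists C : R, forall v, trace_space v -> `|phi v| <= C * trace_norm v].

Section forms.
Context (k : E -> E -> R).

Definition energy (u v : E -> R) : R :=
  2^-1 * \int[(mu \x mu)%E]_(z in ~` (~` Omega `*` ~` Omega))
    ((u z.1 - u z.2) * (v z.1 - v z.2) * k z.1 z.2).

Definition energy_shift (lambda : R) (u v : E -> R) : R :=
  energy u v - lambda * \int[mu]_(x in Omega) (u x * v x).

Definition dirichlet_eigenvalue (lambda : R) :=
  exists psi, [/\ V0_space psi, ~ null_on setT psi &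
    forall v, V0_space v ->
      energy psi v = lambda * \int[mu]_(x in Omega) (psi x * v x)].

Definition dirichlet_solution (lambda : R) (g u : E -> R) :=
  extension g u /\ forall v, V0_space v -> energy_shift lambda u v = 0.

(** Graph of the Dirichlet-to-Neumann map from [trace_space] to [trace_dual]:
    [dtn lambda g phi] says that [phi] is the image of [g]. When [lambda] is not
    a Dirichlet eigenvalue, [u] is the unique solution with exterior data [g]. *)
Definition dtn (lambda : R) (g : E -> R) (phi : (E -> R) -> R) :=
  [/\ trace_space g, trace_dual phi &
    exists2 u, dirichlet_solution lambda g u &
      forall v vt, trace_space v -> extension v vt ->
        phi v = energy_shift lambda u vt].

Context (beta : E -> R).

Definition robin_kernel (lambda : R) : set (E -> R) :=
  [set u | V_space u /\ forall v, V_space v ->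
    mu.-integrable (~` Omega) (fun y => (u y * v y * beta y)%:E) /\
    energy u v + \int[mu]_(y in ~` Omega) (u y * v y * beta y) =
      lambda * \int[mu]_(x in Omega) (u x * v x)].

Definition dtn_kernel (lambda : R) : set (E -> R) :=
  [set g | exists2 phi, dtn lambda g phi & forall v, trace_space v ->
    mu.-integrable (~` Omega) (fun y => (g y * v y * beta y)%:E) /\
    phi v + \int[mu]_(y in ~` Omega) (g y * v y * beta y) = 0].

(** [lambda] is in the point spectrum of [L_beta]. *)
Definition robin_eigenvalue (lambda : R) :=
  exists2 u, robin_kernel lambda u & ~ null_on setT u.

(** [0] is in the point spectrum of [D_lambda + beta]. *)
Definition dtn_zero_eigenvalue (lambda : R) :=
  exists2 g, dtn_kernel lambda g & ~ null_on (~` Omega) g.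

End forms.
End spaces.
End nonlocal.

(* Main.v *)
(** The restriction to the complement of [Omega] maps [ker (L_beta - lambda)]
    onto [ker (D_lambda + beta)], modulo null functions. A Robin eigenfunction
    tested against functions vanishing outside [Omega] solves the Dirichlet
    problem for its own exterior data, and then the two weak equations are the
    same one. If it vanishes outside [Omega] it is a Dirichlet eigenfunction,
    hence zero: the restriction is injective. Since functions on the complement
    are represented by functions on the whole space, the restriction is the
    identity on representatives, so one family is a basis of both kernels.

    Existence of Dirichlet solutions is never needed: an element of
    [dtn_kernel] comes with its solution. *)

Require Import Defs.
From HB Require Import structures.
From mathcomp Require Import all_boot all_order all_algebra.
From mathcomp Require Import all_classical all_reals all_analysis.
From mathcomp Require Import measurable_realfun ring lra.

Set Implicit Arguments.
Unset Strict Implicit.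
Unset Printing Implicit Defensive.

Import Order.TTheory GRing.Theory Num.Theory.
Import numFieldNormedType.Exports.

Local Open Scope classical_set_scope.
Local Open Scope ring_scope.

(** * Existence of bases modulo a set of null vectors *)

(** A linear relation involves finitely many vectors, and these all lie in a single member of the
    chain. This is the chain condition for Zorn's lemma. *)
Lemma free_mod_chain (R : fieldType) (V : lmodType R) (N : set V)
    (F : set (set V)) :
  (forall X, F X -> free_mod N X) -> total_on F subset ->
  free_mod N (\bigcup_(X in F) X).
Proof.
move=> Ffree Ftot [|n] b a b_inj Fb Nab; first by case.
suff [X FX Xb] : exists2 X, F X & forall i, X (b i).
  exact: (Ffree X FX n.+1 b a).
(* Induction on [m] gathers the vectors of index at most [m] in one member; each step keeps the
   larger of two comparable members. *)
suff H m : exists2 X, F X & forall i : 'I_n.+1, (i <= m)%N -> X (b i).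
  by have [X FX Xb] := H n; exists X => // i; apply: Xb; rewrite -ltnS.
elim: m => [|m [X FX Xb]].
  have [X FX Xb] := Fb ord0; exists X => // i i0.
  by rewrite (_ : i = ord0)//; apply/val_inj/eqP; rewrite -leqn0.
have [Y FY Yb] := Fb (inord m.+1).
have bE (i : 'I_n.+1) : i = m.+1 :> nat -> Y (b i).
  by move=> im; rewrite (_ : i = inord m.+1)//; apply/val_inj; rewrite /= -im inord_val.
have [XY|YX] := Ftot _ _ FX FY.
- exists Y => // i; rewrite leq_eqVlt => /orP[/eqP/bE//|im].
  exact/XY/Xb.
- exists X => // i; rewrite leq_eqVlt => /orP[/eqP/bE/YX//|im].
  exact/Xb.
Qed.

(** A maximal free subset [B] of [K] spans: adjoining some [f] of [K] outside [B] destroys freeness,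
    and the resulting relation can be solved for [f]. Stability of [N] under scaling allows division
    by the coefficient of [f]. *)
Lemma basis_mod_exists (R : fieldType) (V : lmodType R) (N K : set V) :
  N 0 -> (forall a u, N u -> N (a *: u)) ->
  exists B, basis_mod N K B.
Proof.
move=> N0 NZ.
have [F FP Ftot|B [[BK Bfree] Bmax]] :=
    @Zorn_bigcup V [set B | B `<=` K /\ free_mod N B].
  split=> [x [X FX Xx]|]; first exact: (FP X FX).1.
  by apply: free_mod_chain => // X /FP[].
exists B; split=> // f Kf.
have [Bf|nBf] := pselect (B f).
  exists 1%N, (fun=> f), (fun=> 1); split=> //.
  by rewrite big_ord1 scale1r subrr.
have : ~ free_mod N (B `|` [set f]).
  move=> Bf; apply: (Bmax (B `|` [set f])); last first.
    by split=> // x [/BK|->].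
  split; first by move=> x; left.
  by move=> /(_ f (or_intror erefl)).
move=> /existsNP[[|n]] /existsNP[b] /existsNP[a] /not_implyP[b_inj]
  /not_implyP[Bb] /not_implyP[Nab]; first by case; case.
move=> /existsNP[i0 ai0].
(* The relation must involve [f], say as [b j], since otherwise it contradicts freeness of [B]. *)
have [Bb'|/existsNP[j nBj]] := pselect (forall i, B (b i)).
  by case: ai0; exact: (Bfree _ b).
have bj : b j = f by case: (Bb j).
have Bl i : B (b (lift j i)).
  case: (Bb (lift j i)) => //; rewrite -bj => /b_inj/eqP.
  by rewrite eq_sym (negbTE (neq_lift _ _)).
rewrite (bigD1_ord j)//= bj in Nab.
(* If [a j] were zero, a relation within [B] would remain, and all coefficients, [a i0] included,
   would vanish. *)
have aj : a j != 0.
  apply/eqP => aj; case: ai0; move: Nab; rewrite aj scale0r add0r => Nab.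
  case: (unliftP j i0) => [i ->|->//].
  apply: (Bfree _ (fun i => b (lift j i)) (fun i => a (lift j i))) => //.
  by move=> x y /b_inj/lift_inj.
exists n, (fun i => b (lift j i)), (fun i => - ((a j)^-1 * a (lift j i))).
split=> //; move: (NZ (a j)^-1 _ Nab).
rewrite scalerDr scalerA mulVf// scale1r; congr (N (_ + _)).
by rewrite -sumrN scaler_sumr; apply: eq_bigr => i _; rewrite scaleNr opprK scalerA.
Qed.

(** * Measurability on the space and off the diagonal *)

(** Boxes with rational centre and radius [1/(n+1)] are finite intersections of coordinate
    preimages, hence measurable. An open set is the countable union of the boxes that it
    contains. *)
Lemma open_measurable_rV (R : realType) (d : nat) (U : set 'rV[R]_d) :
  open U -> measurable U.
Proof.
move=> oU.
pose bx (p : 'rV[rat]_d * nat) : set 'rV[R]_d :=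
  [set x | forall i, `|x ord0 i - ratr (p.1 ord0 i)| < p.2.+1%:R^-1].
have mbx p : measurable (bx p).
  rewrite (_ : bx p = \bigcap_(i in [set: 'I_d]) (rV_coord i @^-1`
      ball (ratr (p.1 ord0 i) : R) p.2.+1%:R^-1)).
    apply: fin_bigcap_measurable => // i _; rewrite -[X in measurable X]setTI.
    by apply: measurable_rV_coord => //; exact: measurable_ball.
  apply/seteqP; split => x /= H i.
  - by move=> _; rewrite /rV_coord /= /ball/= distrC; exact: H.
  - by have := H i I; rewrite /rV_coord /= /ball/= distrC.
rewrite (_ : U = \bigcup_p [set x | bx p x /\ bx p `<=` U]).
  apply: countable_bigcupT_measurable => [|p]; first exact: countableP.
  have [pU|npU] := pselect (bx p `<=` U).
    by rewrite (_ : mkset _ = bx p)//; apply/seteqP; split=> x // [].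
  by rewrite (_ : mkset _ = set0)//; apply/seteqP; split=> x // [].
apply/seteqP; split => [x Ux|x [p _ [bpx +]]]; last exact.
have /nbhs_ballP[e /= e0 xeU] := open_nbhs_nbhs (conj oU Ux).
(* Half of [e], because a point of the box is compared with [x] through the rational centre, at the
   cost of two radii. *)
have [n ne] : exists n : nat, n.+1%:R^-1 < e / 2.
  have := near_infty_natSinv_lt (PosNum (divr_gt0 e0 (ltr0n R 2))).
  by move=> [n _ /(_ n (leqnn _))]; exists n.
have n0 : 0 < n.+1%:R^-1 :> R by rewrite invr_gt0.
pose e1 : R := n.+1%:R^-1; have e1E : e1 = n.+1%:R^-1 by [].
rewrite -e1E in ne n0; clearbody e1.
have /choice[q qx] : forall i, exists q : rat, `|x ord0 i - ratr q| < e1.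
  move=> i; have [|q] := @rat_in_itvoo R (x ord0 i - e1) (x ord0 i + e1).
    by rewrite ltrD2l gtrN.
  rewrite in_itv/= => /andP[q1 q2]; exists q; rewrite ltr_norml.
  by apply/andP; split; lra.
exists (\row_i q i, n) => //; split=> [i|y yb]; first by rewrite mxE -e1E.
apply: xeU; split=> // i j; rewrite [i]ord1; have := yb j; have := qx j; rewrite /= mxE -e1E.
rewrite /ball/= !ltr_norml => /andP[? ?] /andP[? ?]; apply/andP; split; lra.
Qed.

Lemma normrM_le_sqrD (R : realFieldType) (a b : R) :
  `|a * b| <= a ^+ 2 + b ^+ 2.
Proof. by rewrite ler_norml; apply/andP; split; nra. Qed.

Section measurability.
Context (R : realType) (d : nat).
Local Notation E := 'rV[R]_d.

Lemma measurable_sub_rV :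
  measurable_fun setT (fun z : E * E => z.1 - z.2).
Proof.
apply: measurable_fun_rVP => i.
rewrite (_ : _ \o _ = (fun z : E * E => rV_coord i z.1 - rV_coord i z.2)).
  apply: measurable_funB; apply: measurableT_comp => //; exact: measurable_rV_coord.
by apply/funext => z; rewrite /rV_coord/= !mxE.
Qed.

Lemma measurable_neq0_rV : measurable [set~ (0 : E)].
Proof.
apply: open_measurable_rV; rewrite openC.
exact/accessible_closed_set1/hausdorff_accessible/norm_hausdorff.
Qed.

Lemma offdiagE : [set z : E * E | z.1 != z.2] =
  (fun z : E * E => z.1 - z.2) @^-1` [set~ 0].
Proof.
apply/seteqP; split => z /=.
- by move=> /eqP zz /eqP; rewrite subr_eq0 => /eqP.
- by move=> zz; apply/eqP => zE; apply: zz; rewrite zE subrr.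
Qed.

Lemma measurable_offdiag : measurable [set z : E * E | z.1 != z.2].
Proof.
rewrite offdiagE -[X in measurable X]setTI.
exact: measurable_sub_rV measurable_neq0_rV.
Qed.

(** The kernels are controlled only off the diagonal. The increment factor [g] vanishes on the
    diagonal, so the product is measurable everywhere, whatever [f] is there. *)
Lemma measurable_offdiagM (g f : E * E -> R) :
  measurable_fun setT g -> measurable_fun [set z | z.1 != z.2] f ->
  (forall x, g (x, x) = 0) ->
  measurable_fun setT (fun z => g z * f z).
Proof.
move=> mg mf g0.
rewrite -(setvU [set z : E * E | z.1 != z.2]).
have mO := @measurable_offdiag; have mD := measurableC mO.
apply/(measurable_funU _ mD mO); split.
- apply: (eq_measurable_fun (cst (0 : R))); last exact: measurable_cst.
  move=> [x y]; rewrite inE/= => /negP; rewrite negbK => /eqP ->.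
  by rewrite g0 mul0r.
- by apply: measurable_funM => //; exact: measurable_funTS.
Qed.

Lemma measurable_increment (u : E -> R) : measurable_fun setT u ->
  measurable_fun setT (fun z : E * E => u z.1 - u z.2).
Proof. by move=> mfu; apply: measurable_funB; exact: measurableT_comp. Qed.

End measurability.

(** * The function space and its integrability criteria *)

Section forms.
Context (R : realType) (d : nat) (Omega : set 'rV[R]_d) (nu : 'rV[R]_d -> R).
Local Notation E := 'rV[R]_d.
Local Notation mu := (lebesgue_rV R d).
Local Notation mu2 := (lebesgue_rV R d \x lebesgue_rV R d)%E.
Local Notation D := (~` (~` Omega `*` ~` Omega)).
Context (mOmega : measurable Omega) (nu_levy : symmetric_levy_density nu).

(** The integrand of [sqseminorm], put on the product space so that its integrals over different
    domains can be compared. *)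
Definition gagliardo (u : E -> R) (z : E * E) : R :=
  (u z.1 - u z.2) ^+ 2 * nu (z.1 - z.2).

Lemma measurable_gagliardo u : measurable_fun setT u ->
  measurable_fun setT (gagliardo u).
Proof.
move=> mfu; apply: measurable_offdiagM => /=.
- by apply: measurable_funX; exact: measurable_increment.
- rewrite offdiagE; have [mnu _ _ _] := nu_levy.
  apply: (@measurable_comp _ _ _ _ _ _ [set~ (0 : E)] nu _
    (fun z : E * E => z.1 - z.2)) => //.
  - exact: measurable_neq0_rV.
  - by move=> _ [z + <-].
  - by apply: measurable_funTS; exact: measurable_sub_rV.
- by move=> x; rewrite subrr expr0n.
Qed.

Lemma gagliardo_ge0 u z : 0 <= gagliardo u z.
Proof.
have [_ nu0 _ _] := nu_levy; rewrite /gagliardo.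
have [->|z12] := eqVneq z.1 z.2; first by rewrite subrr expr0n mul0r.
by rewrite mulr_ge0 ?sqr_ge0// nu0// subr_eq0.
Qed.

Lemma gagliardo_sym u x y : gagliardo u (x, y) = gagliardo u (y, x).
Proof.
have [_ _ nuN _] := nu_levy; rewrite /gagliardo/=.
have [->//|xy] := eqVneq x y.
by rewrite -(opprB y x) nuN ?subr_eq0 1?eq_sym// -(opprB (u y)) sqrrN.
Qed.

Lemma measurable_mixed : measurable D.
Proof. by apply: measurableC; apply: measurableX; exact: measurableC. Qed.

Lemma sqseminormE u : measurable_fun setT u ->
  sqseminorm Omega nu u = (\int[mu2]_(z in Omega `*` setT) (gagliardo u z)%:E)%E.
Proof.
move=> mfu; have mO : measurable (Omega `*` [set: E]) by exact: measurableX.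
rewrite integral_mkcond fubini_tonelli1/=; first last.
- by move=> z; apply: erestrict_ge0 => ? _; rewrite lee_fin gagliardo_ge0.
- apply/(measurable_restrictT _ _).1 => //; apply: measurable_funTS.
  by apply/measurable_EFinP; exact: measurable_gagliardo.
rewrite /sqseminorm integral_mkcond; apply: eq_integral => x _.
rewrite patchE; case: ifPn => [xO|/negP xO].
- apply: eq_integral => y _; rewrite patchE mem_set//; split => //.
  by move: xO; rewrite inE.
- rewrite /fubini_F integral0_eq// => y _; rewrite patchE memNset// => -[/= + _].
  by move=> ?; apply: xO; rewrite inE.
Qed.

(** Tonelli in the other order, combined with the symmetry of the integrand. *)
Lemma sqseminormE_sym u : measurable_fun setT u ->
  sqseminorm Omega nu u = (\int[mu2]_(z in setT `*` Omega) (gagliardo u z)%:E)%E.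
Proof.
move=> mfu; have mO : measurable ([set: E] `*` Omega) by exact: measurableX.
rewrite integral_mkcond fubini_tonelli2/=; first last.
- by move=> z; apply: erestrict_ge0 => ? _; rewrite lee_fin gagliardo_ge0.
- apply/(measurable_restrictT _ _).1 => //; apply: measurable_funTS.
  by apply/measurable_EFinP; exact: measurable_gagliardo.
rewrite /sqseminorm integral_mkcond; apply: eq_integral => x _.
rewrite patchE; case: ifPn => [xO|/negP xO].
- apply: eq_integral => y _; rewrite patchE mem_set//.
    by rewrite gagliardo_sym.
  by split => //; move: xO; rewrite inE.
- rewrite /fubini_G integral0_eq// => y _; rewrite patchE memNset// => -[/= _].
  by move=> ?; apply: xO; rewrite inE.
Qed.

(** The mixed domain is the disjoint union of [Omega] times the space and of the complement times
    [Omega]; by symmetry the second piece costs at most one more seminorm. *)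
Lemma integral_gagliardo_le u : measurable_fun setT u ->
  (\int[mu2]_(z in D) (gagliardo u z)%:E <=
   sqseminorm Omega nu u + sqseminorm Omega nu u)%E.
Proof.
move=> mfu.
have mg A : measurable_fun A (fun z => (gagliardo u z)%:E).
  by apply: measurable_funTS; apply/measurable_EFinP; exact: measurable_gagliardo.
have mOT : measurable (Omega `*` [set: E]) by exact: measurableX.
have mTO : measurable ([set: E] `*` Omega) by exact: measurableX.
have mCO : measurable (~` Omega `*` Omega).
  by apply: measurableX => //; exact: measurableC.
have g0 z : (0 <= (gagliardo u z)%:E)%E by rewrite lee_fin gagliardo_ge0.
rewrite {1}sqseminormE// sqseminormE_sym//.
rewrite (_ : D = (Omega `*` setT) `|` (~` Omega `*` Omega)).
  rewrite ge0_integral_setU//.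
    by apply: leeD2l; apply: ge0_subset_integral => //; move=> [x y] [].
  by apply/disj_setPS => -[x y] [[/= ? _] []].
apply/seteqP; split=> [[x y] /=|[x y] [[/= ? _] []//|[/= _ ?] []//]].
move=> /not_andP H; have [?|?] := pselect (Omega x); first by left.
by right; split=> //; case: H => // /contrapT.
Qed.

(** Replaces the one-sided seminorm by integrability over the whole domain of the energy, which is
    what the bilinear form requires. *)
Lemma V_spaceP u : V_space Omega nu u <->
  [/\ measurable_fun setT u,
      mu.-integrable Omega (EFin \o (fun x => u x ^+ 2)) &
      mu2.-integrable D (EFin \o gagliardo u)].
Proof.
split => [[mfu L2u Su]|[mfu L2u Su]]; split => //.
- apply/integrableP; split.
    by apply: measurable_funTS; apply/measurable_EFinP; exact: measurable_funX.
  by under eq_integral do rewrite /= ger0_norm ?sqr_ge0//.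
- apply/integrableP; split.
    by apply: measurable_funTS; apply/measurable_EFinP; exact: measurable_gagliardo.
  under eq_integral do rewrite /= ger0_norm ?gagliardo_ge0//.
  by apply: (le_lt_trans (integral_gagliardo_le mfu)); rewrite lte_add_pinfty.
- move/integrableP : L2u => [_]; apply: le_lt_trans.
  by under [leRHS]eq_integral do rewrite /= ger0_norm ?sqr_ge0//.
- have /integrableP[_] : mu2.-integrable (Omega `*` setT) (EFin \o gagliardo u).
    apply: integrableS Su; [exact: measurable_mixed|exact: measurableX|].
    by move=> [x y] [/= ? _] [].
  apply: le_lt_trans; rewrite sqseminormE//.
  by under [leRHS]eq_integral do rewrite /= ger0_norm ?gagliardo_ge0//.
Qed.


(** Both integrands are dominated through [(s + t)^2 + (s - t)^2 = 2 s^2 + 2 t^2]; the gap is the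
    same integrand taken for [a u - v]. *)
Lemma V_space_lin a u v : V_space Omega nu u -> V_space Omega nu v ->
  V_space Omega nu (fun x => a * u x + v x).
Proof.
move=> /V_spaceP[mfu iu gu] /V_spaceP[mfv iv gv].
have muv : measurable_fun setT (fun x => a * u x + v x).
  by apply: measurable_funD => //; exact: measurable_funM.
apply/V_spaceP; split => //.
- apply: (le_integrable mOmega _ _
    (integrableD mOmega (integrableZl mOmega (2 * a ^+ 2) iu)
      (integrableZl mOmega 2 iv))).
    by apply: measurable_funTS; apply/measurable_EFinP; exact: measurable_funX.
  move=> x _ /=; rewrite lee_fin ger0_norm ?sqr_ge0//.
  apply: le_trans (ler_norm _).
  rewrite -subr_ge0 [leRHS](_ : _ = (a * u x - v x) ^+ 2); first exact: sqr_ge0.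
  ring.
- have mD := measurable_mixed.
  apply: (le_integrable mD _ _
    (integrableD mD (integrableZl mD (2 * a ^+ 2) gu) (integrableZl mD 2 gv))).
    by apply: measurable_funTS; apply/measurable_EFinP; exact: measurable_gagliardo.
  move=> z _ /=; rewrite lee_fin ger0_norm ?gagliardo_ge0//.
  apply: le_trans (ler_norm _).
  have nu0 : 0 <= gagliardo (fun x => a * u x - v x) z by exact: gagliardo_ge0.
  rewrite -subr_ge0; apply: le_trans nu0 _; rewrite le_eqVlt; apply/orP; left.
  by apply/eqP; rewrite /gagliardo; ring.
Qed.

Lemma V_space0 : V_space Omega nu (fun=> 0).
Proof.
apply/V_spaceP; split; first exact: measurable_cst.
- apply: (eq_integrable _ (cst 0%E)) => //; last exact: integrable0.
  by move=> x _ /=; rewrite expr0n.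
- apply: (eq_integrable _ (cst 0%E)); [exact: measurable_mixed| |exact: integrable0].
  by move=> x _ /=; rewrite /gagliardo subrr expr0n mul0r.
Qed.

Lemma V_spaceB u v : V_space Omega nu u -> V_space Omega nu v ->
  V_space Omega nu (fun x => u x - v x).
Proof.
move=> Vu Vv; have := V_space_lin (-1) Vv Vu.
by congr V_space; apply/funext => x; rewrite mulN1r addrC.
Qed.

Lemma integrable_V_mul u v : V_space Omega nu u -> V_space Omega nu v ->
  mu.-integrable Omega (EFin \o (fun x => u x * v x)).
Proof.
move=> /V_spaceP[mfu iu _] /V_spaceP[mfv iv _].
apply: (le_integrable mOmega _ _ (integrableD mOmega iu iv)).
  by apply: measurable_funTS; apply/measurable_EFinP; exact: measurable_funM.
move=> x _ /=; rewrite lee_fin [leRHS]ger0_norm ?addr_ge0 ?sqr_ge0//.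
exact: normrM_le_sqrD.
Qed.

(** The square of a norm dominating the forms; unlike [V_norm] it charges the
    whole domain of integration of the energy. *)
Definition mixed_sqnorm (u : E -> R) : R :=
  \int[mu]_(x in Omega) u x ^+ 2 + \int[mu2]_(z in D) gagliardo u z.

Lemma mixed_sqnorm_ge0 u : 0 <= mixed_sqnorm u.
Proof.
apply: addr_ge0; apply: Rintegral_ge0 => x _; first exact: sqr_ge0.
exact: gagliardo_ge0.
Qed.

(** The factor 2 is the one lost in [integral_gagliardo_le]. *)
Lemma mixed_sqnorm_le u : V_space Omega nu u ->
  mixed_sqnorm u <= 2 * V_norm Omega nu u ^+ 2.
Proof.
move=> Vu; have [mfu L2u Su] := Vu; have /V_spaceP[_ _ gu] := Vu.
have L20 : (0 <= sqL2 Omega u)%E.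
  by apply: integral_ge0 => x _; rewrite lee_fin sqr_ge0.
have S0 : (0 <= sqseminorm Omega nu u)%E.
  apply: integral_ge0 => x _; apply: integral_ge0 => y _.
  by rewrite lee_fin (gagliardo_ge0 u (x, y)).
have L2f : sqL2 Omega u \is a fin_num by rewrite ge0_fin_numE.
have Sf : sqseminorm Omega nu u \is a fin_num by rewrite ge0_fin_numE.
rewrite /V_norm sqr_sqrtr; last by apply: fine_ge0; exact: adde_ge0.
rewrite fineD//.
have gS : \int[mu2]_(z in D) gagliardo u z <=
    fine (sqseminorm Omega nu u) + fine (sqseminorm Omega nu u).
  rewrite -fineD// /Rintegral; apply: fine_le.
  - exact: integrable_fin_num measurable_mixed _ gu.
  - by rewrite fin_numD Sf.
  - exact: integral_gagliardo_le.
have L2E : \int[mu]_(x in Omega) u x ^+ 2 = fine (sqL2 Omega u) by [].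
rewrite /mixed_sqnorm L2E; move: gS (fine_ge0 L20); clear.
by move: (Rintegral _ _ _) (fine _) (fine _) => g l s; lra.
Qed.

Lemma mixed_sqnormZ t u : V_space Omega nu u ->
  mixed_sqnorm (fun x => t * u x) = t ^+ 2 * mixed_sqnorm u.
Proof.
move=> /V_spaceP[mfu iu gu]; rewrite /mixed_sqnorm mulrDr.
rewrite -(RintegralZl _ mOmega iu) -(RintegralZl _ measurable_mixed gu).
by congr (_ + _); apply: eq_Rintegral => z _; rewrite /gagliardo; ring.
Qed.

(** * Bilinearity and boundedness of the shifted energy *)

Section bounded_kernel.
Context (k : E -> E -> R) (Lambda : R)
  (k_measurable : measurable_fun [set z : E * E | z.1 != z.2]
     (fun z : E * E => k z.1 z.2))
  (k_ge0 : forall x y, x != y -> 0 <= k x y)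
  (k_le : forall x y, x != y -> k x y <= Lambda * nu (y - x)).

Definition energy_density (u v : E -> R) (z : E * E) : R :=
  (u z.1 - u z.2) * (v z.1 - v z.2) * k z.1 z.2.

(** Off the diagonal, [k] is at most [Lambda] times [nu] and the product of increments is at most
    the sum of their squares; on the diagonal both sides are zero. Symmetry of [nu] reconciles the
    two orders of the difference. *)
Lemma energy_density_le u v z :
  `|energy_density u v z| <= Lambda * (gagliardo u z + gagliardo v z).
Proof.
rewrite /energy_density /gagliardo.
have [->|z12] := eqVneq z.1 z.2; first by rewrite !subrr !(mul0r, expr0n, addr0, mulr0) normr0.
have [_ nu0 nuN _] := nu_levy.
have nuE : nu (z.1 - z.2) = nu (z.2 - z.1).
  by rewrite -opprB nuN// subr_eq0 eq_sym.
have := k_le z12; have := k_ge0 z12; rewrite -nuE.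
move: (k _ _) (nu _) (u z.1 - u z.2) (v z.1 - v z.2) => K n a b K0 Kn.
rewrite -mulrDl mulrCA; apply: (@le_trans _ _ ((a ^+ 2 + b ^+ 2) * K)).
  rewrite normrM (ger0_norm K0); apply: ler_wpM2r => //.
  exact: normrM_le_sqrD.
by apply: ler_wpM2l => //; rewrite addr_ge0 ?sqr_ge0 ?ler0n.
Qed.

Lemma measurable_energy_density u v : measurable_fun setT u ->
  measurable_fun setT v -> measurable_fun setT (energy_density u v).
Proof.
move=> mfu mfv; apply: measurable_offdiagM => //.
  by apply: measurable_funM; exact: measurable_increment.
by move=> x /=; rewrite subrr mul0r.
Qed.

Lemma integrable_energy_density u v : V_space Omega nu u -> V_space Omega nu v ->
  mu2.-integrable D (EFin \o energy_density u v).
Proof.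
move=> /V_spaceP[mfu iu gu] /V_spaceP[mfv iv gv].
have mD := measurable_mixed.
apply: (le_integrable mD _ _ (integrableZl mD Lambda (integrableD mD gu gv))).
  by apply: measurable_funTS; apply/measurable_EFinP; exact: measurable_energy_density.
move=> z _ /=; rewrite lee_fin; apply: le_trans (energy_density_le _ _ _) _.
exact: ler_norm.
Qed.

Local Notation es := (energy_shift Omega k).

Lemma energy_shiftC lambda u v : es lambda u v = es lambda v u.
Proof.
rewrite /energy_shift /energy; congr (_ * _ - _ * _); apply: eq_Rintegral => z _.
  by rewrite [X in X * _]mulrC.
exact: mulrC.
Qed.

Lemma energy_shift_linr lambda a u v w :
  V_space Omega nu u -> V_space Omega nu v -> V_space Omega nu w ->
  es lambda u (fun x => a * v x + w x) = a * es lambda u v + es lambda u w.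
Proof.
move=> Vu Vv Vw; rewrite /energy_shift /energy.
have mD := measurable_mixed.
have -> : \int[mu2]_(z in D) ((u z.1 - u z.2) *
    (a * v z.1 + w z.1 - (a * v z.2 + w z.2)) * k z.1 z.2) =
    a * \int[mu2]_(z in D) energy_density u v z +
    \int[mu2]_(z in D) energy_density u w z.
  have iv := integrable_energy_density Vu Vv.
  have iw := integrable_energy_density Vu Vw.
  rewrite -(RintegralZl _ mD iv) -(RintegralD mD (integrableZl mD a iv) iw).
  by apply: eq_Rintegral => z _; rewrite /energy_density/=; ring.
have -> : \int[mu]_(x in Omega) (u x * (a * v x + w x)) =
    a * \int[mu]_(x in Omega) (u x * v x) + \int[mu]_(x in Omega) (u x * w x).
  have iv := integrable_V_mul Vu Vv.
  have iw := integrable_V_mul Vu Vw.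
  rewrite -(RintegralZl _ mOmega iv) -(RintegralD mOmega (integrableZl mOmega a iv) iw).
  by apply: eq_Rintegral => z _; ring.
rewrite /energy_density; ring.
Qed.

Lemma energy_shift_linl lambda a u v w :
  V_space Omega nu u -> V_space Omega nu v -> V_space Omega nu w ->
  es lambda (fun x => a * v x + w x) u = a * es lambda v u + es lambda w u.
Proof. by move=> Vu Vv Vw; rewrite energy_shiftC energy_shift_linr// !(energy_shiftC _ u). Qed.

(** The pointwise bounds are integrated. A one-sided estimate is enough, since it will be applied to
    multiples of [v] of either sign. *)
Lemma energy_shift_le lambda u v : 0 <= Lambda ->
  V_space Omega nu u -> V_space Omega nu v ->
  es lambda u v <= (Lambda + `|lambda|) * (mixed_sqnorm u + mixed_sqnorm v).
Proof.
move=> L0 Vu Vv.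
have [_ iu gu] := (V_spaceP u).1 Vu; have [_ iv gv] := (V_spaceP v).1 Vv.
have mD := measurable_mixed.
have energyE : \int[mu2]_(z in D) energy_density u v z <=
    Lambda * (\int[mu2]_(z in D) gagliardo u z + \int[mu2]_(z in D) gagliardo v z).
  rewrite -(RintegralD mD gu gv) -(RintegralZl _ mD (integrableD mD gu gv)).
  apply: le_Rintegral => //.
  - exact: integrable_energy_density.
  - exact: (integrableZl mD Lambda (integrableD mD gu gv)).
  - by move=> z _; exact: le_trans (ler_norm _) (energy_density_le _ _ _).
have L2E : - (lambda * \int[mu]_(x in Omega) (u x * v x)) <=
    `|lambda| * (\int[mu]_(x in Omega) u x ^+ 2 + \int[mu]_(x in Omega) v x ^+ 2).
  have iuv := integrable_V_mul Vu Vv.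
  rewrite -mulNr -(RintegralD mOmega iu iv) -(RintegralZl _ mOmega iuv).
  rewrite -(RintegralZl _ mOmega (integrableD mOmega iu iv)).
  apply: le_Rintegral => //.
  - exact: (integrableZl mOmega (- lambda) iuv).
  - exact: (integrableZl mOmega `|lambda| (integrableD mOmega iu iv)).
  - move=> x _; apply: le_trans (ler_norm _) _; rewrite normrM normrN.
    by apply: ler_wpM2l => //; exact: normrM_le_sqrD.
rewrite /energy_shift /energy -/(energy_density u v) /mixed_sqnorm.
have gu0 : 0 <= \int[mu2]_(z in D) gagliardo u z.
  by apply: Rintegral_ge0 => z _; exact: gagliardo_ge0.
have gv0 : 0 <= \int[mu2]_(z in D) gagliardo v z.
  by apply: Rintegral_ge0 => z _; exact: gagliardo_ge0.
have u0 : 0 <= \int[mu]_(x in Omega) u x ^+ 2.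
  by apply: Rintegral_ge0 => z _; exact: sqr_ge0.
have v0 : 0 <= \int[mu]_(x in Omega) v x ^+ 2.
  by apply: Rintegral_ge0 => z _; exact: sqr_ge0.
(* With the integrals abstracted to real variables, the claim is linear once the products with [L]
   and [l] are known to be nonnegative. *)
suff arith (L l en p g1 g2 u1 v1 : R) : 0 <= L -> 0 <= l ->
    0 <= g1 -> 0 <= g2 -> 0 <= u1 -> 0 <= v1 ->
    en <= L * (g1 + g2) -> - p <= l * (u1 + v1) ->
    2^-1 * en - p <= (L + l) * (u1 + g1 + (v1 + g2)).
  exact: arith.
move=> L1 l0 g10 g20 u10 v10 enL pl.
have Lg1 := mulr_ge0 L1 g10; have Lg2 := mulr_ge0 L1 g20.
have Lu1 := mulr_ge0 L1 u10; have Lv1 := mulr_ge0 L1 v10.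
have lg1 := mulr_ge0 l0 g10; have lg2 := mulr_ge0 l0 g20.
clear -enL pl Lg1 Lg2 Lu1 Lv1 lg1 lg2; lra.
Qed.

(** Cauchy-Schwarz up to a constant: optimise [energy_shift_le] over the scaling
    [v |-> t * v]. *)
Lemma energy_shift_bounded lambda u : 0 <= Lambda -> V_space Omega nu u ->
  exists2 C, 0 < C &
    forall v, V_space Omega nu v -> `|es lambda u v| <= C * V_norm Omega nu v.
Proof.
move=> L0 Vu; pose c := Lambda + `|lambda|.
have c0 : 0 <= c by rewrite addr_ge0.
have M0 := mixed_sqnorm_ge0 u.
(* The scaling argument gives [c * (mixed_sqnorm u + 2)]; the added 1 makes the constant strictly
   positive, so that one can divide by it. *)
exists (c * (mixed_sqnorm u + 2) + 1).
  by rewrite ltr_wpDl// mulr_ge0// addr_ge0.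
move=> v Vv; set n := V_norm Omega nu v; set x := es lambda u v.
have n0 : 0 <= n by exact: sqrtr_ge0.
have tx t : t * x <= c * (mixed_sqnorm u + t ^+ 2 * (2 * n ^+ 2)).
  have := energy_shift_linr lambda t Vu Vv V_space0.
  have -> : es lambda u (fun=> 0) = 0.
    have := energy_shift_linr lambda (-1) Vu V_space0 V_space0.
    rewrite (_ : (fun=> -1 * 0 + 0) = fun=> 0); last by apply/funext => y; rewrite mulr0 addr0.
    by rewrite mulN1r addNr.
  rewrite addr0 (_ : (fun x => t * v x + 0) = fun x => t * v x); last first.
    by apply/funext => y; rewrite addr0.
  move=> <-; have Vtv : V_space Omega nu (fun x => t * v x).
    have := V_space_lin t Vv V_space0.
    by congr V_space; apply/funext => y; rewrite addr0.
  apply: le_trans (energy_shift_le lambda L0 Vu Vtv) _.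
  apply: ler_wpM2l => //; apply: lerD => //; rewrite mixed_sqnormZ//.
  by apply: ler_wpM2l; [exact: sqr_ge0|exact: mixed_sqnorm_le].
move: M0 tx; move: (mixed_sqnorm u) x n n0 => m x n n0 m0 tx.
have [nE|nN] := eqVneq n 0.
  have cm0 : 0 <= c * m by exact: mulr_ge0.
  rewrite nE mulr0 normr_le0; apply: contraT => x0.
  (* For norm zero the bound reads [t * x <= c * m] for all [t]; this [t] makes the left side
     [c * m + 1]. *)
  have := tx ((c * m + 1) / x); rewrite mulfVK// nE expr0n !mulr0 addr0; lra.
have np : 0 < n by rewrite lt0r nN.
(* The choice [t = s / n] normalises [v]; the signs [s = 1] and [s = -1] give the two halves of the
   absolute value. *)
have txn s : s ^+ 2 = 1 -> s * x <= c * (m + 2) * n.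
  move=> s1; have := tx (s / n).
  rewrite exprMn exprVn s1 mul1r mulrCA mulVf ?sqrf_eq0// mulr1.
  by rewrite mulrAC ler_pdivrMr.
apply: (@le_trans _ _ (c * (m + 2) * n)); last first.
  by rewrite ler_wpM2r// lerDl.
rewrite ler_norml -lerN2 opprK -mulN1r txn ?sqrrN ?expr1n// -{1}[x]mul1r.
by rewrite txn// expr1n.
Qed.

End bounded_kernel.
End forms.

(** * Functions vanishing almost everywhere *)

Section null_functions.
Context (R : realType) (d : nat) (D : set 'rV[R]_d).
Local Notation E := 'rV[R]_d.
Local Notation mu := (lebesgue_rV R d).

Lemma null_on0 : null_on D (0 : E -> R).
Proof. exact: ae_eq_refl. Qed.

Lemma null_on_scale (a : R) (f : E -> R) : null_on D f -> null_on D (a *: f).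
Proof.
by apply: filterS => x fx /fx fx0; rewrite -[LHS]/(a * f x) fx0 /cst mulr0.
Qed.

Lemma null_onD (f g : E -> R) : null_on D f -> null_on D g -> null_on D (f + g).
Proof.
by apply: filterS2 => x fx gx Dx; rewrite -[LHS]/(f x + g x) fx// gx// /cst addr0.
Qed.

Lemma null_on_setU (f : E -> R) : null_on setT f -> null_on D f.
Proof. exact: ae_eq_subset. Qed.

Lemma null_on_transfer (f g : E -> R) : ae_eq mu D f g -> null_on D f -> null_on D g.
Proof. by move=> /ae_eq_sym; exact: ae_eq_trans. Qed.

End null_functions.

(** * Passage between the Robin and Dirichlet-to-Neumann kernels *)

Section robin_dtn.
Context (R : realType) (d : nat) (Omega : set 'rV[R]_d)
  (nu : 'rV[R]_d -> R) (k : 'rV[R]_d -> 'rV[R]_d -> R)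
  (Lambda lambda : R) (beta : 'rV[R]_d -> R).
Local Notation E := 'rV[R]_d.
Local Notation mu := (lebesgue_rV R d).
Context (mOmega : measurable Omega) (nu_levy : symmetric_levy_density nu)
  (k_measurable : measurable_fun [set z : E * E | z.1 != z.2]
     (fun z : E * E => k z.1 z.2))
  (k_ge0 : forall x y, x != y -> 0 <= k x y)
  (Lambda_ge0 : 0 <= Lambda)
  (k_le : forall x y, x != y -> k x y <= Lambda * nu (y - x))
  (lambda_not_dirichlet : ~ dirichlet_eigenvalue Omega nu k lambda)
  (beta_measurable : measurable_fun (~` Omega) beta).
Local Notation V := (V_space Omega nu).
Local Notation es := (energy_shift Omega k lambda).
Local Notation robin := (robin_kernel Omega nu k beta lambda).
Local Notation dtnK := (dtn_kernel Omega nu k beta lambda).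

Lemma V_trace u : V u -> trace_space Omega nu u.
Proof. by move=> Vu; exists u. Qed.

Lemma V0_space_sub g u v : extension Omega nu g u -> extension Omega nu g v ->
  V0_space Omega nu (fun x => u x - v x).
Proof.
move=> [Vu ug] [Vv vg]; split; first exact: V_spaceB.
by apply: filterS2 ug vg => x ug vg Ox; rewrite ug// vg// subrr.
Qed.

(** Moving the [lambda] term to the left gives the Robin equation the shape of the equation defining
    [dtn_kernel]. *)
Lemma robin_kernelP u : robin u <-> V u /\ forall v, V v ->
  mu.-integrable (~` Omega) (fun y => (u y * v y * beta y)%:E) /\
  es u v + \int[mu]_(y in ~` Omega) (u y * v y * beta y) = 0.
Proof.
split => -[Vu H]; split => // v Vv; have [i e] := H v Vv; split => //.
- by rewrite /energy_shift addrAC e subrr.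
- by apply/eqP; rewrite -subr_eq0 addrAC; exact/eqP.
Qed.

Lemma robin_kernel0 : robin 0.
Proof.
have V0 := V_space0 mOmega nu_levy.
apply/robin_kernelP; split=> // v Vv; split.
  apply: (eq_integrable _ (cst 0%E)); [exact: measurableC| |exact: integrable0].
  by move=> y _; rewrite /cst -[X in X * _ * _]/(0 : R) !mul0r.
have -> : es 0 v = 0.
  have := energy_shift_linl mOmega nu_levy k_measurable k_ge0 k_le lambda (-1)
    Vv V0 V0.
  rewrite [in RHS]mulN1r [in RHS]addNr => h; rewrite -[RHS]h; congr (energy_shift _ _ _ _ _).
  by apply/funext => y; rewrite mulr0 addr0.
rewrite add0r /Rintegral integral0_eq// => y _.
by rewrite -[X in X * _ * _]/(0 : R) !mul0r.
Qed.

Lemma robin_kernel_lin a u w : robin u -> robin w ->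
  robin (fun x => a * u x + w x).
Proof.
move=> /robin_kernelP[Vu Hu] /robin_kernelP[Vw Hw]; apply/robin_kernelP.
split=> [|v Vv]; first exact: V_space_lin.
have [iu eu] := Hu v Vv; have [iw ew] := Hw v Vv.
have mC := measurableC mOmega.
have E1 y : (a * u y + w y) * v y * beta y =
  a * (u y * v y * beta y) + w y * v y * beta y by ring.
split.
  have := integrableD mC (integrableZl mC a iu) iw.
  by apply: eq_integrable => // y _ /=; rewrite E1.
under eq_Rintegral do rewrite E1.
rewrite (RintegralD mC (integrableZl mC a iu) iw) (RintegralZl _ mC iu).
rewrite (energy_shift_linl mOmega nu_levy k_measurable k_ge0 k_le)//.
by rewrite addrACA -mulrDr eu ew mulr0 addr0.
Qed.

(** Serves the transfer of freeness: [robin_null] is applied to linear combinations of basis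
    elements. *)
Lemma robin_kernel_sum n (a : 'I_n -> R) (b : 'I_n -> (E -> R)) :
  (forall i, robin (b i)) -> robin (\sum_(i < n) a i *: b i).
Proof.
move=> rb; elim/big_ind : _ => [||i _]; first exact: robin_kernel0.
  move=> u w ru rw; have := robin_kernel_lin 1 ru rw.
  by congr robin; apply/funext => x; rewrite mul1r.
have := robin_kernel_lin (a i) (rb i) robin_kernel0.
by congr robin; apply/funext => x; exact: addr0.
Qed.

(** The exterior integral vanishes together with [v], so only the Dirichlet equation remains. *)
Lemma robin_energy_shift_V0 u v : robin u -> V0_space Omega nu v -> es u v = 0.
Proof.
move=> /robin_kernelP[Vu Hu] [Vv v0]; have [i] := Hu v Vv.
rewrite (_ : \int[mu]_(y in ~` Omega) _ = 0) ?addr0//.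
have mC := measurableC mOmega.
rewrite /Rintegral (@ae_eq_integral _ _ _ _ _ (cst 0%E)) ?integral0//.
- exact: measurable_int i.
- by apply: filterS v0 => y vy Oy; rewrite vy// /cst mulr0 mul0r.
Qed.

(** Injectivity of the restriction; [lambda_not_dirichlet] enters here. *)
Lemma robin_null u : robin u -> null_on (~` Omega) u -> null_on setT u.
Proof.
move=> ru u0; apply: contrapT => nu0; apply: lambda_not_dirichlet; exists u.
have Vu : V u by case: ru.
split=> // v Vv; apply/eqP; rewrite -subr_eq0; apply/eqP.
exact: (robin_energy_shift_V0 ru Vv).
Qed.

(** The functional is [es u] evaluated at a chosen extension. As [es u] vanishes on [V0_space], the
    choice is immaterial, which yields both linearity and boundedness in the quotient norm. *)
Lemma robin_dtn u : robin u -> dtnK u.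
Proof.
move=> ru; have [Vu Hu] := (robin_kernelP u).1 ru.
(* A functional on all functions is required; the default 0 is taken outside the trace space, where
   nothing is claimed. *)
pose ext v := xget 0 [set w | V w /\ forall y, ~ Omega y -> v y = w y].
have extP v : trace_space Omega nu v -> V (ext v) /\ forall y, ~ Omega y -> v y = ext v y.
  by move=> [w Vw vw]; apply: (@xgetPex _ 0 [set w | V w /\ _]); exists w.
have extE v w : trace_space Omega nu v -> extension Omega nu v w ->
    es u (ext v) = es u w.
  move=> /extP[Vev ve] vw.
  have evx : extension Omega nu v (ext v).
    by split=> //; apply: aeW => y Oy; rewrite ve.
  have /(robin_energy_shift_V0 ru) := V0_space_sub evx vw.
  have [Vw _] := vw.
  have -> : (fun x => ext v x - w x) = (fun x => -1 * w x + ext v x).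
    by apply/funext => x; rewrite mulN1r addrC.
  rewrite (energy_shift_linr mOmega nu_levy k_measurable k_ge0 k_le)//.
  by rewrite mulN1r addrC => /eqP; rewrite subr_eq0 => /eqP.
exists (fun v => es u (ext v)).
  split; first exact: V_trace.
  - split.
      move=> a v w Tv Tw; have [Vv vE] := extP v Tv; have [Vw wE] := extP w Tw.
      (* The combination of the chosen extensions extends the combination, so [extE] compares it
         with the extension chosen for that combination. *)
      rewrite -(energy_shift_linr mOmega nu_levy k_measurable k_ge0 k_le)//.
      apply: extE.
        exists (fun y => a * ext v y + ext w y); first exact: V_space_lin.
        by move=> y Oy; rewrite vE// wE.
      split; first exact: V_space_lin.
      by apply: aeW => y Oy; rewrite vE// wE.
    have [C C0 HC] := energy_shift_bounded mOmega nu_levy k_measurable k_ge0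
      k_le lambda Lambda_ge0 Vu.
    (* After division by [C], the value is a lower bound for the norms of all extensions [w],
       because [es u w] does not depend on [w]; hence it is at most their infimum. *)
    exists C => v Tv; rewrite mulrC -ler_pdivrMr//; apply: lb_le_inf.
      have [Vv vE] := extP v Tv; exists (V_norm Omega nu (ext v)), (ext v) => //.
      by split=> //; apply: aeW => y Oy; rewrite vE.
    move=> _ [w vw <-]; rewrite ler_pdivrMr// mulrC (extE v w Tv vw).
    by apply: HC; case: vw.
  - exists u; last by move=> v w; exact: extE.
    by split; [split => //; exact: ae_eq_refl|move=> v; exact: robin_energy_shift_V0].
move=> v Tv; have [Vv vE] := extP v Tv; have [i e] := Hu _ Vv; split.
  move: i; apply: eq_integrable => [|y]; first exact: measurableC.
  by rewrite inE => Oy; rewrite vE.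
rewrite -[RHS]e; congr (_ + _); apply: eq_Rintegral => y; rewrite inE => Oy.
by rewrite vE.
Qed.

(** The Dirichlet solution [u] behind [g] is the Robin function: each [v] in [V] extends its own
    trace, so [phi v] is [es u v], and the exterior terms agree almost everywhere. *)
Lemma dtn_robin g : dtnK g -> exists2 u, robin u & ae_eq mu (~` Omega) u g.
Proof.
move=> [phi [Tg _ [u [[Vu ug] usol] phiE]] Hphi]; exists u => //.
apply/robin_kernelP; split=> // v Vv; have [i e] := Hphi v (V_trace Vv).
have mC := measurableC mOmega.
(* Almost everywhere equality with the integrand for [g] does not transport measurability, so it is
   derived from the factors. *)
have muv : measurable_fun (~` Omega) (fun y => (u y * v y * beta y)%:E).
  apply/measurable_EFinP; apply: measurable_funM => //.
  by apply: measurable_funTS; apply: measurable_funM; [case: Vu|case: Vv].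
have aeE : ae_eq mu (~` Omega) (fun y => (u y * v y * beta y)%:E)
    (fun y => (g y * v y * beta y)%:E).
  by apply: filterS ug => y ugy Oy; rewrite ugy.
have mgv := measurable_int _ i.
split.
  apply/integrableP; split => //; have /integrableP[_] := i.
  apply: le_lt_trans; rewrite le_eqVlt; apply/orP; left; apply/eqP.
  apply: ge0_ae_eq_integral => //.
  - exact: measurableT_comp.
  - exact: measurableT_comp.
  - exact: ae_eq_abse.
rewrite -[RHS]e (phiE v v (V_trace Vv)); last by split=> //; exact: ae_eq_refl.
by congr (_ + fine _); exact: ae_eq_integral.
Qed.

End robin_dtn.

(** * Equality of point spectra and of dimensions *)

Theorem theorem4p23 (R : realType) (d : nat) (Omega : set 'rV[R]_d)
    (nu : 'rV[R]_d -> R) (k : 'rV[R]_d -> 'rV[R]_d -> R)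
    (Lambda lambda : R) (beta : 'rV[R]_d -> R)
    (Omega_open : open Omega) (Omega_bounded : bounded_set Omega)
    (nu_levy : symmetric_levy_density nu)
    (nu_full : density_support nu = setT)
    (nu_infinite : (\int[lebesgue_rV R d]_h (nu h)%:E = +oo)%E)
    (k_measurable : measurable_fun [set z | z.1 != z.2]
       (fun z : 'rV[R]_d * 'rV[R]_d => k z.1 z.2))
    (k_ge0 : forall x y, x != y -> 0 <= k x y)
    (k_sym : forall x y, x != y -> k x y = k y x)
    (Lambda_ge1 : 1 <= Lambda)
    (k_bounds : forall x y, x != y ->
       Lambda^-1 * nu (y - x) <= k x y <= Lambda * nu (y - x))
    (lambda_not_dirichlet : ~ dirichlet_eigenvalue Omega nu k lambda)
    (beta_measurable : measurable_fun (~` Omega) beta) :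
  (dtn_zero_eigenvalue Omega nu k beta lambda <->
     robin_eigenvalue Omega nu k beta lambda) /\
  eq_dim_mod (null_on setT) (robin_kernel Omega nu k beta lambda)
    (null_on (~` Omega)) (dtn_kernel Omega nu k beta lambda).
Proof.
have mOmega := open_measurable_rV Omega_open.
have Lambda_ge0 : 0 <= Lambda by exact: le_trans ler01 Lambda_ge1.
have k_le x y : x != y -> k x y <= Lambda * nu (y - x).
  by move=> /k_bounds/andP[].
have r0 u := @robin_null _ _ _ _ _ _ _ mOmega lambda_not_dirichlet u.
have rd u := @robin_dtn _ _ _ _ _ _ _ beta mOmega nu_levy k_measurable k_ge0
  Lambda_ge0 k_le u.
have dr g := @dtn_robin _ _ _ nu k lambda _ mOmega beta_measurable g.
split; first split => [[g dg g0]|[u ru u0]].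
- have [u ru ug] := dr _ dg; exists u => // /null_on_setU u0.
  by apply: g0; exact: null_on_transfer ug (u0 _).
- exists u; first exact: rd.
  by move=> uC; apply: u0; exact: r0 ru uC.
(* A basis modulo functions null on the whole space; it is then shown to be one modulo functions
   null outside [Omega]. *)
have [B [BK Bfree Bspan]] := basis_mod_exists
  (robin_kernel Omega nu k beta lambda) (@null_on0 _ _ setT)
  (@null_on_scale _ _ setT).
exists B, B; split => //; first split.
- by move=> u /BK/rd.
(* A combination that is null outside [Omega] is a Robin function, hence null everywhere. *)
- move=> n b a b_inj Bb N0; apply: (Bfree n b a b_inj Bb); apply: r0 => //.
  by apply: (robin_kernel_sum mOmega nu_levy k_measurable k_ge0 k_le) => i; exact: BK.
(* The Robin function with the exterior values of [g] is expanded in [B], and the expansion is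
   restricted to the complement. *)
- move=> g /dr[u ru ug]; have [n [b [a [Bb Nu]]]] := Bspan u ru.
  exists n, b, a; split => //.
  apply: (null_on_transfer _ (@null_on_setU _ _ (~` Omega) _ Nu)).
  by apply: filterS ug => x ugx Ox; rewrite -[LHS]/(u x + _) ugx.
Qed.
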